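(* Let $\mathcal{B}_0$ and $\mathcal{B}_1$ be $A_\infty$-operads with $\mathcal{B}_0$ cofibrant in the model structure on $\mathcal{OPER}$, and fix a morphism $f:\mathcal{B}_0\to\mathcal{B}_1$. For $a\in\mathbf{k}^\times$ let $a*f:\mathcal{B}_0\to\mathcal{B}_1$ be the morphism with $(a*f)_n=a^{n-1}f_n$ in arity $n$. Then the map $\mathbf{k}^\times\to[\mathcal{B}_0,\mathcal{B}_1]$, $a\mapsto[a*f]$, is a bijection, where $[\mathcal{B}_0,\mathcal{B}_1]$ denotes the set of (left or right) homotopy classes of morphisms $\mathcal{B}_0\to\mathcal{B}_1$.
   Context: $\mathbf{k}$ is a field; $\mathcal{OPER}$ is the category of non-$\Sigma$ operads in non-negatively graded chain complexes over $\mathbf{k}$, with the model structure in which weak equivalences are the arity-wise quasi-isomorphisms and fibrations are the morphisms that are surjective in every arity $n\ge0$ and every degree $k\ge1$ (every object is fibrant). An $A_\infty$-operad is an operad weakly equivalent (via a zigzag of arity-wise quasi-isomorphisms) to the associative operad $\mathcal{A}$. *)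

(* Defs.v *)
From HB Require Import structures.
From mathcomp Require Import all_boot all_order all_algebra.
Set Implicit Arguments. Unset Strict Implicit. Unset Printing Implicit Defensive.
Import Order.TTheory GRing.Theory Num.Theory.
Local Open Scope ring_scope.

Section DGOperads.
Variable K : fieldType.

(* Raw data of a dg non-Sigma operad: components O(n)_k (arity n : nat,
   homological degree k : int), differential d : O(n)_k -> O(n)_(k-1),
   partial compositions  x o_i y  (i is 0-indexed, meaningful for i < m),
   and the unit in O(1)_0. *)
Record dgop := DGOp {
  opc : nat -> int -> lmodType K;
  opd : forall n k, opc n k -> opc n (k - 1);
  opcomp : forall m p n q, nat -> opc m p -> opc n q -> opc (m + n)%N.-1 (p + q);
  opunit : opc 1 0
}.
Arguments opd _ {n k}.
Arguments opcomp _ {m p n q}.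

Definition ocast (O : dgop) m m' k k' (e1 : m = m') (e2 : k = k')
    (x : opc O m k) : opc O m' k' :=
  match e1 in _ = m1 return opc O m1 k' with
  | erefl => match e2 in _ = k1 return opc O m k1 with erefl => x end
  end.

Definition heq (O : dgop) m k m' k' (x : opc O m k) (y : opc O m' k') : Prop :=
  exists (e1 : m = m') (e2 : k = k'), ocast e1 e2 x = y.

Lemma degL (p q : int) : p - 1 + q = p + q - 1.
Proof. by rewrite addrAC. Qed.
Lemma degR (p q : int) : p + (q - 1) = p + q - 1.
Proof. by rewrite addrA. Qed.

(* the sign (-1)^p for a degree p (only used for p >= 0) *)
Definition sgn (p : int) : K := (-1) ^+ `|p|%N.

Definition is_operad (O : dgop) : Prop :=
  (forall n k (x : opc O n k), k < 0 -> x = 0) /\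
  (forall n k a (x y : opc O n k), opd O (a *: x + y) = a *: opd O x + opd O y) /\
  (forall n k (x : opc O n k), opd O (opd O x) = 0) /\
  (forall m p n q i a (x x' : opc O m p) (y : opc O n q), (i < m)%N ->
     opcomp O i (a *: x + x') y = a *: opcomp O i x y + opcomp O i x' y) /\
  (forall m p n q i a (x : opc O m p) (y y' : opc O n q), (i < m)%N ->
     opcomp O i x (a *: y + y') = a *: opcomp O i x y + opcomp O i x y') /\
  (forall m p n q i (x : opc O m p) (y : opc O n q), (i < m)%N ->
     opd O (opcomp O i x y) =
       ocast erefl (degL p q) (opcomp O i (opd O x) y)
       + sgn p *: ocast erefl (degR p q) (opcomp O i x (opd O y))) /\
  (forall l p m q n r i j (x : opc O l p) (y : opc O m q) (z : opc O n r),
     (i < l)%N -> (j < m)%N ->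
     heq (opcomp O (i + j)%N (opcomp O i x y) z) (opcomp O i x (opcomp O j y z))) /\
  (forall l p m q n r i k (x : opc O l p) (y : opc O m q) (z : opc O n r),
     (i < k)%N -> (k < l)%N ->
     heq (opcomp O (k + m)%N.-1 (opcomp O i x y) z)
         ((-1) ^+ (`|q| * `|r|)%N *: opcomp O i (opcomp O k x z) y)) /\
  (forall n q (y : opc O n q), heq (opcomp O 0%N (opunit O) y) y) /\
  (forall m p i (x : opc O m p), (i < m)%N -> heq (opcomp O i x (opunit O)) x).

Definition ohom (O P : dgop) := forall n k, opc O n k -> opc P n k.

Definition is_morphism (O P : dgop) (f : ohom O P) : Prop :=
  (forall n k a (x y : opc O n k), f n k (a *: x + y) = a *: f n k x + f n k y) /\
  (forall n k (x : opc O n k), f n (k - 1) (opd O x) = opd P (f n k x)) /\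
  (forall m p n q i (x : opc O m p) (y : opc O n q), (i < m)%N ->
     f _ _ (opcomp O i x y) = opcomp P i (f m p x) (f n q y)) /\
  f 1%N 0 (opunit O) = opunit P.

(* arity-wise quasi-isomorphism: the induced map on homology H_(k-1) is
   injective and surjective, for every arity n and every degree k *)
Definition quasi_iso (O P : dgop) (f : ohom O P) : Prop :=
  forall n k,
    (forall (z : opc O n (k - 1)) (w : opc P n k),
        opd O z = 0 -> f n (k - 1) z = opd P w ->
        exists u : opc O n k, z = opd O u) /\
    (forall z' : opc P n (k - 1), opd P z' = 0 ->
        exists (z : opc O n (k - 1)) (w : opc P n k),
          opd O z = 0 /\ f n (k - 1) z - z' = opd P w).

Definition fibration (O P : dgop) (f : ohom O P) : Prop :=
  forall n k, 1 <= k -> forall y : opc P n k, exists x, f n k x = y.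

(* cofibrant object: left lifting property of the initial map against all
   trivial fibrations, i.e. every morphism to the base of a trivial
   fibration lifts through it *)
Definition cofibrant (B : dgop) : Prop :=
  forall (X Y : dgop) (p : ohom X Y) (g : ohom B Y),
    is_operad X -> is_operad Y -> is_morphism p -> fibration p -> quasi_iso p ->
    is_morphism g ->
    exists h : ohom B X, is_morphism h /\
      forall n k (x : opc B n k), p n k (h n k x) = g n k x.

(* right homotopy through a path object B1 -> P -> B1 x B1
   (s a weak equivalence, (p0,p1) a fibration) *)
Definition homotopic (B0 B1 : dgop) (f g : ohom B0 B1) : Prop :=
  exists (P : dgop) (s : ohom B1 P) (p0 p1 : ohom P B1) (H : ohom B0 P),
    [/\ is_operad P, is_morphism s, is_morphism p0, is_morphism p1 & quasi_iso s] /\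
    (forall n k (x : opc B1 n k), p0 n k (s n k x) = x /\ p1 n k (s n k x) = x) /\
    (forall n k, 1 <= k -> forall y0 y1 : opc B1 n k,
        exists x, p0 n k x = y0 /\ p1 n k x = y1) /\
    is_morphism H /\
    (forall n k (x : opc B0 n k), p0 n k (H n k x) = f n k x /\ p1 n k (H n k x) = g n k x).

(* the associative operad: A(n) = K concentrated in degree 0, for all n >= 0,
   all compositions given by multiplication.  Component = 'rV_1 = K in degree 0
   and the zero space 'rV_0 otherwise. *)
Definition coefv (b : nat) (x : 'rV[K]_b) : K := \sum_(j < b) x 0 j.

Definition assoc_op : dgop :=
  @DGOp (fun _ k => 'rV[K]_(k == 0))
        (fun _ _ _ => 0)
        (fun _ _ _ _ _ x y => \row_j (coefv x * coefv y))
        (\row_j 1).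

Inductive zigzag : dgop -> dgop -> Prop :=
  | zz_refl O : zigzag O O
  | zz_fwd O P (f : ohom O P) : is_operad O -> is_operad P -> is_morphism f ->
      quasi_iso f -> zigzag O P
  | zz_bwd O P (f : ohom P O) : is_operad O -> is_operad P -> is_morphism f ->
      quasi_iso f -> zigzag O P
  | zz_trans O P Q : zigzag O P -> zigzag P Q -> zigzag O Q.

Definition A_infinity (B : dgop) : Prop := is_operad B /\ zigzag B assoc_op.

Definition oscale (O P : dgop) (a : K) (f : ohom O P) : ohom O P :=
  fun n k x => a ^ (n%:Z - 1) *: f n k x.

End DGOperads.

(* Main.v *)
(* An A-infinity operad B has the associative operad as homology: B is acyclic
   in positive degrees, and H_0(B)(n) is the line spanned by the class of mu_n,
   which is a nullary element e for n = 0, the unit for n = 1 and the left comb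
   of a binary element m for n >= 2, with [m o_0 e] = [1] <> 0.  These
   properties pass along quasi-isomorphisms in both directions, hence along
   zigzags, starting from the associative operad itself.

   A morphism phi : B0 -> B1 therefore maps [mu_n] to beta^(n-1) [mu'_n] for a
   unique beta <> 0 (the relation [m o_0 e] = [1] forces the scalar on e to be
   beta^-1), and a * phi has coefficient a * beta.  Morphisms inducing the same
   map on H_0 are homotopic through the path object of pairs (x, y) whose
   degree-0 components are homologous; conversely a homotopy forces agreement on
   H_0, and evaluating at m shows that the coefficient is a homotopy invariant. *)

From HB Require Import structures.
Require Import Defs.
From mathcomp Require Import all_boot all_order all_algebra.
From mathcomp Require Import boolp zify.
Import GRing.Theory Num.Theory.
Local Open Scope ring_scope.
Set Implicit Arguments. Unset Strict Implicit. Unset Printing Implicit Defensive.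

Section LinearFun.
Variables (K : pzRingType) (V W : lmodType K) (F : V -> W).
Hypothesis linF : linear F.

Lemma lin_funB x y : F (x - y) = F x - F y.
Proof. exact: zmod_morphism_linear. Qed.
Lemma lin_fun0 : F 0 = 0.
Proof. by rewrite -(subrr 0) lin_funB subrr. Qed.
Lemma lin_funD x y : F (x + y) = F x + F y.
Proof. by have := linF 1 x y; rewrite !scale1r. Qed.
Lemma lin_funZ a x : F (a *: x) = a *: F x.
Proof. exact: scalable_linear. Qed.
End LinearFun.

Lemma ocast_id (K : fieldType) (O : dgop K) m k (e1 : m = m) (e2 : k = k)
  (x : opc O m k) : ocast e1 e2 x = x.
Proof. by rewrite (eq_irrelevance e1 erefl) (eq_irrelevance e2 erefl). Qed.

Lemma ocast0 (K : fieldType) (O : dgop K) m m' k k' (e1 : m = m') (e2 : k = k') :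
  ocast e1 e2 (0 : opc O m k) = 0.
Proof. by case: m' / e1; case: k' / e2. Qed.

Section OperadAxioms.
Variables (K : fieldType) (O : dgop K).
Hypothesis hO : is_operad O.

Lemma opc_neg n k (x : opc O n k) : k < 0 -> x = 0.
Proof. by case: hO => h _; apply: h. Qed.
Lemma opd_linear n k : linear (@opd _ O n k).
Proof. by case: hO => _ [h _] a x y; apply: h. Qed.
Lemma opd0 n k : opd (0 : opc O n k) = 0.
Proof. by rewrite (lin_fun0 (@opd_linear n k)). Qed.
Lemma opdD n k (x y : opc O n k) : opd (x + y) = opd x + opd y.
Proof. by rewrite (lin_funD (@opd_linear n k)). Qed.
Lemma opdZ n k a (x : opc O n k) : opd (a *: x) = a *: opd x.
Proof. by rewrite (lin_funZ (@opd_linear n k)). Qed.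
Lemma opdB n k (x y : opc O n k) : opd (x - y) = opd x - opd y.
Proof. by rewrite (lin_funB (@opd_linear n k)). Qed.
Lemma opdN n k (x : opc O n k) : opd (- x) = - opd x.
Proof. by rewrite -scaleN1r opdZ scaleN1r. Qed.
Lemma opdK n k (x : opc O n k) : opd (opd x) = 0.
Proof. by case: hO => _ [_ [h _]]. Qed.
Lemma opd_deg0 n (x : opc O n 0) : opd x = 0.
Proof. exact: opc_neg. Qed.

Lemma opcompl_linear m p n q i (y : opc O n q) : (i < m)%N ->
  linear (fun x : opc O m p => opcomp i x y).
Proof. by case: hO => _ [_ [_ [h _]]] hi a x x'; apply: h. Qed.
Lemma opcompr_linear m p n q i (x : opc O m p) : (i < m)%N ->
  linear (fun y : opc O n q => opcomp i x y).
Proof. by case: hO => _ [_ [_ [_ [h _]]]] hi a y y'; apply: h. Qed.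

Lemma opcomp_leibniz m p n q i (x : opc O m p) (y : opc O n q) : (i < m)%N ->
  opd (opcomp i x y) = ocast erefl (degL p q) (opcomp i (opd x) y)
                       + sgn K p *: ocast erefl (degR p q) (opcomp i x (opd y)).
Proof. by case: hO => _ [_ [_ [_ [_ [h _]]]]]; apply: h. Qed.

Lemma opcomp0l m p n q i (y : opc O n q) : (i < m)%N ->
  opcomp i (0 : opc O m p) y = 0.
Proof. by move=> hi; rewrite (lin_fun0 (@opcompl_linear m p n q i y hi)). Qed.
Lemma opcomp0r m p n q i (x : opc O m p) : (i < m)%N ->
  opcomp i x (0 : opc O n q) = 0.
Proof. by move=> hi; rewrite (lin_fun0 (@opcompr_linear m p n q i x hi)). Qed.

Lemma opcompBl m p n q i (x x' : opc O m p) (y : opc O n q) : (i < m)%N ->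
  opcomp i (x - x') y = opcomp i x y - opcomp i x' y.
Proof. by move=> hi; rewrite (lin_funB (@opcompl_linear m p n q i y hi)). Qed.
Lemma opcompBr m p n q i (x : opc O m p) (y y' : opc O n q) : (i < m)%N ->
  opcomp i x (y - y') = opcomp i x y - opcomp i x y'.
Proof. by move=> hi; rewrite (lin_funB (@opcompr_linear m p n q i x hi)). Qed.

Lemma opcompZZ m p n q i c c' (x : opc O m p) (y : opc O n q) : (i < m)%N ->
  opcomp i (c *: x) (c' *: y) = (c * c') *: opcomp i x y.
Proof.
move=> hi; rewrite (lin_funZ (@opcompl_linear m p n q i _ hi)).
by rewrite (lin_funZ (@opcompr_linear m p n q i x hi)) scalerA.
Qed.
End OperadAxioms.

Section DegreeZeroHomology.
Variables (K : fieldType) (O : dgop K).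
Hypothesis hO : is_operad O.

Definition boundary n (y : opc O n 0) : Prop := exists w : opc O n 1, y = opd w.
Definition homologous n (x y : opc O n 0) : Prop := boundary (x - y).

Lemma boundary0 n : boundary (0 : opc O n 0).
Proof. by exists 0; rewrite (opd0 hO). Qed.
Lemma boundaryD n (x y : opc O n 0) : boundary x -> boundary y -> boundary (x + y).
Proof. by move=> [w ->] [w' ->]; exists (w + w'); rewrite (opdD hO). Qed.
Lemma boundaryB n (x y : opc O n 0) : boundary x -> boundary y -> boundary (x - y).
Proof. by move=> [w ->] [w' ->]; exists (w - w'); rewrite (opdB hO). Qed.
Lemma boundaryZ n a (x : opc O n 0) : boundary x -> boundary (a *: x).
Proof. by move=> [w ->]; exists (a *: w); rewrite (opdZ hO). Qed.

Lemma homologous_refl n (x : opc O n 0) : homologous x x.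
Proof. by rewrite /homologous subrr; apply: boundary0. Qed.
Lemma homologous_sym n (x y : opc O n 0) : homologous x y -> homologous y x.
Proof.
by move=> hxy; rewrite /homologous -opprB -sub0r; apply: boundaryB (boundary0 _) hxy.
Qed.
Lemma homologous_trans n (x y z : opc O n 0) :
  homologous x y -> homologous y z -> homologous x z.
Proof.
move=> hxy hyz; rewrite /homologous.
have -> : x - z = (x - y) - (z - y) by rewrite opprB addrA subrK.
exact: boundaryB hxy (homologous_sym hyz).
Qed.
Lemma homologousZ n a (x y : opc O n 0) :
  homologous x y -> homologous (a *: x) (a *: y).
Proof. by move=> hxy; rewrite /homologous -scalerBr; apply: boundaryZ. Qed.
Lemma homologous_boundary n (x y : opc O n 0) :
  homologous x y -> boundary y -> boundary x.
Proof.
move=> hxy hy; have -> : x = (x - y) - (0 - y) by rewrite sub0r opprK subrK.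
exact: boundaryB hxy (boundaryB (boundary0 _) hy).
Qed.

Lemma homologous_scale n c c' (x : opc O n 0) :
  ~ boundary x -> homologous (c *: x) (c' *: x) -> c = c'.
Proof.
move=> nbx hc; apply/eqP; rewrite -subr_eq0; apply/negPn/negP => hcc'.
apply: nbx; rewrite -[x](scalerK hcc'); apply: boundaryZ.
by rewrite scalerBl.
Qed.

Lemma opd_opcomp10 m n i (w : opc O m 1) (y : opc O n 0) : (i < m)%N ->
  opd (opcomp i w y : opc O _ 1) = opcomp i (opd w) y.
Proof.
move=> hi; have := opcomp_leibniz hO w y hi.
by rewrite !ocast_id (opd_deg0 hO y) opcomp0r // scaler0 => ->; apply: addr0.
Qed.
Lemma opd_opcomp01 m n i (x : opc O m 0) (w : opc O n 1) : (i < m)%N ->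
  opd (opcomp i x w : opc O _ 1) = opcomp i x (opd w).
Proof.
move=> hi; have := opcomp_leibniz hO x w hi.
rewrite !ocast_id (opd_deg0 hO x) opcomp0l // [sgn _ _]expr0 scale1r => ->.
exact: add0r.
Qed.

Lemma homologous_opcomp m n i (x x' : opc O m 0) (y y' : opc O n 0) : (i < m)%N ->
  homologous x x' -> homologous y y' -> homologous (opcomp i x y) (opcomp i x' y').
Proof.
move=> hi [w hw] [w' hw']; exists (opcomp i w y + opcomp i x' w' : opc O _ 1).
rewrite (opdD hO) opd_opcomp10 // opd_opcomp01 // -hw -hw'.
by rewrite (opcompBl hO) // (opcompBr hO) // addrA subrK.
Qed.
End DegreeZeroHomology.

Section Morphism.
Unset Implicit Arguments.
Variables (K : fieldType) (O P : dgop K) (f : ohom O P).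
Set Implicit Arguments.
Hypothesis hf : is_morphism f.

Lemma morph_linear n k : linear (f n k).
Proof. by case: hf => h _ a x y; apply: h. Qed.
Lemma morph0 n k : f n k 0 = 0.
Proof. by rewrite (lin_fun0 (@morph_linear n k)). Qed.
Lemma morphZ n k a (x : opc O n k) : f n k (a *: x) = a *: f n k x.
Proof. by rewrite (lin_funZ (@morph_linear n k)). Qed.
Lemma morphB n k (x y : opc O n k) : f n k (x - y) = f n k x - f n k y.
Proof. by rewrite (lin_funB (@morph_linear n k)). Qed.

Lemma morph_opd n k (x : opc O n k) : f n (k - 1) (opd x) = opd (f n k x).
Proof. by case: hf => _ [h _]. Qed.
Lemma morph_opcomp m p n q i (x : opc O m p) (y : opc O n q) : (i < m)%N ->
  f _ _ (opcomp i x y) = opcomp i (f m p x) (f n q y).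
Proof. by case: hf => _ [_ [h _]]; apply: h. Qed.
Lemma morph_unit : f 1%N 0 (opunit O) = opunit P.
Proof. by case: hf => _ [_ [_ h]]. Qed.

Lemma morph_boundary n (x : opc O n 0) : boundary x -> boundary (f n 0 x).
Proof. by move=> [w ->]; exists (f n 1 w); exact: (morph_opd w). Qed.
Lemma morph_homologous n (x y : opc O n 0) :
  homologous x y -> homologous (f n 0 x) (f n 0 y).
Proof. by move=> hxy; rewrite /homologous -morphB; apply: morph_boundary. Qed.

Hypotheses (hO : is_operad O) (hq : quasi_iso f).

Lemma qiso_boundary n (z : opc O n 0) : boundary (f n 0 z) -> boundary z.
Proof.
move=> [w hw]; have [inj _] := hq n 1.
by have [u hu] := inj z w (opd_deg0 hO z) hw; exists u.
Qed.
Lemma qiso_homologous n (x y : opc O n 0) :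
  homologous (f n 0 x) (f n 0 y) -> homologous x y.
Proof. by rewrite /homologous -morphB; apply: qiso_boundary. Qed.

Hypothesis hP : is_operad P.

Lemma qiso_homologous_surj n (y : opc P n 0) : exists z, homologous (f n 0 z) y.
Proof.
have [_ surj] := hq n 1; have [z [w [_ hw]]] := surj y (opd_deg0 hP y).
by exists z; exists w.
Qed.
End Morphism.

Section AssocHomology.
Variables (K : fieldType) (O : dgop K).
Hypothesis hO : is_operad O.

Fixpoint comb (m : opc O 2%N 0) k : opc O k.+2 0 :=
  match k with 0 => m | k'.+1 => opcomp 0 m (comb m k') end.

Definition assoc_elt (e : opc O 0%N 0) (m : opc O 2%N 0) n : opc O n 0 :=
  match n with 0 => e | 1 => opunit O | k.+2 => comb m k end.

(* [H_j(O) = 0] for [j >= 1]. *)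
Definition acyclic_pos : Prop :=
  forall n k, 2 <= k -> forall z : opc O n (k - 1),
    opd z = 0 -> exists u : opc O n k, z = opd u.

Definition ass_homology (e : opc O 0%N 0) (m : opc O 2%N 0) : Prop :=
  [/\ acyclic_pos, ~ boundary (opunit O), homologous (opcomp 0 m e) (opunit O)
    & forall n (x : opc O n 0), exists lam, homologous x (lam *: assoc_elt e m n)].

Lemma combZ c m k : comb (c *: m) k = c ^+ k.+1 *: comb m k.
Proof.
elim: k => [|k IH] /=; first by rewrite expr1.
by rewrite IH (opcompZZ hO) // -exprS.
Qed.

Lemma assoc_eltZ c e m n :
  assoc_elt (c^-1 *: e) (c *: m) n = c ^ (n%:Z - 1) *: assoc_elt e m n.
Proof.
case: n => [|[|k]] /=; first by rewrite exprN1.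
  by rewrite expr0z scale1r.
by rewrite combZ (_ : k.+2%:Z - 1 = k.+1) //; lia.
Qed.

Lemma assoc_elt_homologous e e' m m' n : homologous e e' -> homologous m m' ->
  homologous (assoc_elt e m n) (assoc_elt e' m' n).
Proof.
move=> he hm; case: n => [|[|k]] //=; first exact: homologous_refl.
by elim: k => [|k IH] //=; exact: (homologous_opcomp hO (isT : (0 < 2)%N) hm IH).
Qed.
End AssocHomology.

Lemma morph_assoc_elt (K : fieldType) (O P : dgop K) (f : ohom O P) e m n :
  is_morphism f -> f n 0 (assoc_elt e m n) = assoc_elt (f 0%N 0 e) (f 2%N 0 m) n.
Proof.
move=> hf; case: n => [|[|k]] //=; first exact: morph_unit.
by elim: k => [|k IH] //=; rewrite -IH; apply: (morph_opcomp hf m (comb m k)).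
Qed.

Section QisoAssHomology.
Unset Implicit Arguments.
Variables (K : fieldType) (O P : dgop K) (f : ohom O P).
Set Implicit Arguments.
Hypotheses (hO : is_operad O) (hP : is_operad P).
Hypotheses (hf : is_morphism f) (hq : quasi_iso f).

Lemma qiso_acyclic_pos : acyclic_pos O <-> acyclic_pos P.
Proof.
split=> hacyc n k hk z hz.
- have [_ surj] := hq n k; have [z0 [w [hz0 hzw]]] := surj z hz.
  have [u hu] := hacyc n k hk z0 hz0.
  exists (f n k u - w); rewrite (opdB hP) -(morph_opd hf u) -hu -hzw.
  by rewrite subKr.
- have hfz : opd (f n (k - 1) z) = 0 by rewrite -(morph_opd hf) hz (morph0 hf).
  have [u hu] := hacyc n k hk _ hfz.
  by have [inj _] := hq n k; apply: (inj z u hz hu).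
Qed.

Lemma qiso_unit_boundary : boundary (opunit O) <-> boundary (opunit P).
Proof.
split=> hb; first by rewrite -(morph_unit hf); apply: morph_boundary.
by apply: (qiso_boundary hO hq); rewrite (morph_unit hf).
Qed.

Lemma qiso_ass_homology e m :
  ass_homology e m -> ass_homology (f 0%N 0 e) (f 2%N 0 m).
Proof.
case=> hacyc hunit hme hspan; split.
- exact/qiso_acyclic_pos.
- by rewrite -qiso_unit_boundary.
- rewrite -(morph_unit hf) -(morph_opcomp hf m e (isT : (0 < 2)%N)).
  exact: morph_homologous.
- move=> n y; have [z hz] := qiso_homologous_surj hq hP y.
  have [lam hl] := hspan n z; exists lam.
  rewrite -(morph_assoc_elt _ _ _ hf) -(morphZ hf).
  apply: (homologous_trans hP (homologous_sym hP hz)).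
  apply: (morph_homologous hf hl).
Qed.

Lemma qiso_ass_homology_inv (e' : opc P 0%N 0) (m' : opc P 2%N 0) :
  ass_homology e' m' -> exists e m, @ass_homology K O e m.
Proof.
case=> hacyc hunit hme hspan.
have [e he] := qiso_homologous_surj hq hP e'.
have [m hm] := qiso_homologous_surj hq hP m'.
have hmu n : homologous (f n 0 (assoc_elt e m n)) (assoc_elt e' m' n).
  by rewrite (morph_assoc_elt _ _ _ hf); apply: assoc_elt_homologous.
exists e, m; split.
- exact/qiso_acyclic_pos.
- by rewrite qiso_unit_boundary.
- apply: (qiso_homologous hf hO hq).
  rewrite (morph_unit hf) (morph_opcomp hf m e (isT : (0 < 2)%N)).
  apply: (homologous_trans hP _ hme).
  exact: (homologous_opcomp hP (isT : (0 < 2)%N) hm he).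
- move=> n x; have [lam hl] := hspan n (f n 0 x); exists lam.
  apply: (qiso_homologous hf hO hq); rewrite (morphZ hf).
  apply: (homologous_trans hP hl).
  exact: (homologousZ hP _ (homologous_sym hP (hmu n))).
Qed.
End QisoAssHomology.

Lemma zigzag_ass_homology (K : fieldType) (O P : dgop K) : zigzag O P ->
  (exists e m, @ass_homology K O e m) <-> (exists e m, @ass_homology K P e m).
Proof.
elim=> {O P} [O|O P f hO hP hf hq|O P f hO hP hf hq|O P Q _ IH1 _ IH2] //.
- split=> [[e [m h]]|[e [m h]]]; last exact: (qiso_ass_homology_inv hO hP hf hq h).
  by exists (f 0%N 0 e), (f 2%N 0 m); apply: qiso_ass_homology.
- split=> [[e [m h]]|[e [m h]]]; first exact: (qiso_ass_homology_inv hP hO hf hq h).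
  by exists (f 0%N 0 e), (f 2%N 0 m); apply: qiso_ass_homology.
- by rewrite IH1 IH2.
Qed.

Section AssocOperad.
Variable K : fieldType.

Definition assoc_one : 'rV[K]_1 := \row_j 1.

Lemma coefv_assoc_one : coefv assoc_one = 1.
Proof. by rewrite /coefv big_ord1 mxE. Qed.

Lemma comb_assoc k : comb (assoc_one : opc (assoc_op K) 2%N 0) k = assoc_one.
Proof.
elim: k => [|k IH] //=; rewrite IH; apply/rowP => j; rewrite !mxE.
by rewrite coefv_assoc_one mulr1.
Qed.

Lemma assoc_op_ass_homology :
  ass_homology (assoc_one : opc (assoc_op K) 0%N 0) assoc_one.
Proof.
split.
- move=> n k hk z _; exists 0; move: z.
  change (forall z : 'rV[K]_(k - 1 == 0), z = 0).
  have hk0 : false = (k - 1 == 0) by apply/esym/negbTE; lia.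
  by case: (k - 1 == 0) / hk0 => z; apply/rowP => -[].
- move=> [w /(congr1 (fun v : 'rV[K]_1 => v 0 0))].
  by rewrite !mxE => /eqP; rewrite oner_eq0.
- exists 0; apply/rowP => j; rewrite !mxE.
  by rewrite coefv_assoc_one mulr1 subrr.
- move=> n x; exists (x 0 0); exists 0.
  case: n x => [|[|k]] x /=; rewrite ?comb_assoc;
  by apply/rowP => j; rewrite !mxE (ord1 j) mulr1 subrr.
Qed.
End AssocOperad.

Lemma A_infinity_ass_homology (K : fieldType) (B : dgop K) :
  A_infinity B -> exists e m, @ass_homology K B e m.
Proof.
case=> _ hz; apply/(zigzag_ass_homology hz).
by exists (assoc_one K), (assoc_one K); apply: assoc_op_ass_homology.
Qed.

Record lin_closed (R : pzRingType) (V : lmodType R) := LinClosed {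
  lc_pred :> V -> Prop;
  lc_pred0 : lc_pred 0;
  lc_predD : forall a x y, lc_pred x -> lc_pred y -> lc_pred (a *: x + y) }.

Section LinClosedSubmodule.
Variables (R : pzRingType) (V : lmodType R) (S : lin_closed V).

Definition lc_mem : {pred V} := fun x => `[< S x >].

Lemma lc_memP x : reflect (S x) (x \in lc_mem).
Proof. exact: asboolP. Qed.

Lemma lc_mem_submod_closed : submod_closed lc_mem.
Proof.
split=> [|a x y /lc_memP hx /lc_memP hy]; apply/lc_memP; first exact: lc_pred0.
exact: lc_predD.
Qed.

HB.instance Definition _ :=
  GRing.isSubmodClosed.Build R V lc_mem lc_mem_submod_closed.

Record lc_sub := LcSub { lcval : V; lcvalP : lcval \in lc_mem }.

HB.instance Definition _ := [isSub for lcval].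
HB.instance Definition _ := [Choice of lc_sub by <:].
HB.instance Definition _ := [SubChoice_isSubLmodule of lc_sub by <:].

Lemma lcval_inj : injective lcval.
Proof. exact: val_inj. Qed.
Lemma lcvalD (x y : lc_sub) : lcval (x + y) = lcval x + lcval y.
Proof. by []. Qed.
Lemma lcvalB (x y : lc_sub) : lcval (x - y) = lcval x - lcval y.
Proof. by []. Qed.
Lemma lcvalZ a (x : lc_sub) : lcval (a *: x) = a *: lcval x.
Proof. by []. Qed.
End LinClosedSubmodule.
Arguments lcval {R V S}.

Section PathObject.
Variables (K : fieldType) (B : dgop K).
Hypothesis hB : is_operad B.

(* No condition outside degree 0; quantifying over the equation [k = 0] avoids
   a dependent case split on the degree. *)
Definition path_rel n k (z : opc B n k * opc B n k) : Prop :=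
  forall e : k = 0, boundary (ocast erefl e (z.1 - z.2)).

Lemma path_rel0 n k : path_rel (0 : opc B n k * opc B n k).
Proof. by move=> e; subst k; rewrite ocast_id subrr; apply: boundary0. Qed.

Lemma path_relD n k a (z z' : opc B n k * opc B n k) :
  path_rel z -> path_rel z' -> path_rel (a *: z + z').
Proof.
move=> hz hz' e; have := hz e; have := hz' e; subst k; rewrite !ocast_id /=.
move=> h' h; rewrite opprD addrACA -scalerBr.
by apply: boundaryD => //; apply: boundaryZ.
Qed.

Definition path_lc n k : lin_closed (opc B n k * opc B n k)%type :=
  LinClosed (@path_rel0 n k) (@path_relD n k).
Definition path_comp n k : lmodType K := lc_sub (path_lc n k).

Definition path_elt n k (z : opc B n k * opc B n k) (hz : path_rel z) :
    path_comp n k :=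
  LcSub (introT (lc_memP (path_lc n k) z) hz).

Lemma path_rel_deg n k (z : opc B n k * opc B n k) : k != 0 -> path_rel z.
Proof. by move=> hk e; exfalso; move: hk; rewrite e eqxx. Qed.

Lemma path_rel_of n k (z : path_comp n k) : path_rel (lcval z).
Proof. exact: (elimT (lc_memP _ _) (lcvalP z)). Qed.

Lemma path_rel_opd n k (z : path_comp n k) :
  path_rel (opd (lcval z).1, opd (lcval z).2).
Proof.
move=> e; have ek : k = 1 by lia.
subst k; rewrite ocast_id /= -(opdB hB).
by exists ((lcval z).1 - (lcval z).2).
Qed.

Lemma path_rel_const n k (x : opc B n k) : path_rel (x, x).
Proof. by move=> e; subst k; rewrite ocast_id subrr; apply: boundary0. Qed.

Definition path_d n k (z : path_comp n k) : path_comp n (k - 1) :=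
  path_elt (path_rel_opd z).

Definition pair_opcomp m p n q i (x : path_comp m p) (y : path_comp n q) :=
  (opcomp i (lcval x).1 (lcval y).1, opcomp i (lcval x).2 (lcval y).2).

Lemma path_rel_opcomp m p n q i (x : path_comp m p) (y : path_comp n q) :
  (i < m)%N -> path_rel (pair_opcomp i x y).
Proof.
move=> hi e; have hx := path_rel_of x; have hy := path_rel_of y.
have [p_neg|p_ge0] := ltrP p 0.
  rewrite /pair_opcomp (opc_neg hB (lcval x).1 p_neg) (opc_neg hB (lcval x).2 p_neg).
  by rewrite !opcomp0l // subrr ocast0; apply: boundary0.
have [q_neg|q_ge0] := ltrP q 0.
  rewrite /pair_opcomp (opc_neg hB (lcval y).1 q_neg) (opc_neg hB (lcval y).2 q_neg).
  by rewrite !opcomp0r // subrr ocast0; apply: boundary0.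
have p0 : p = 0 by lia.
have q0 : q = 0 by lia.
subst p q; rewrite ocast_id.
exact: (homologous_opcomp hB hi (hx erefl) (hy erefl)).
Qed.

(* The default value [0] is only taken for an out-of-range index [i]. *)
Definition path_opcomp m p n q i (x : path_comp m p) (y : path_comp n q) :
    path_comp (m + n).-1 (p + q) :=
  if pselect (path_rel (pair_opcomp i x y)) is left h then path_elt h else 0.

Lemma path_opcompE m p n q i (x : path_comp m p) (y : path_comp n q) :
  (i < m)%N -> lcval (path_opcomp i x y) = pair_opcomp i x y.
Proof.
by move=> hi; rewrite /path_opcomp; case: pselect => // /(_ (path_rel_opcomp x y hi)).
Qed.

Definition path_op : dgop K :=
  @DGOp K path_comp path_d path_opcomp (path_elt (path_rel_const (opunit B))).

Lemma lcval_ocast m m' k k' (e1 : m = m') (e2 : k = k') (z : opc path_op m k) :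
  lcval (ocast e1 e2 z) = (ocast e1 e2 (lcval z).1, ocast e1 e2 (lcval z).2).
Proof. by case: m' / e1; case: k' / e2; case: (lcval z). Qed.

Lemma heq_path m k m' k' (z : opc path_op m k) (z' : opc path_op m' k') :
  heq (lcval z).1 (lcval z').1 -> heq (lcval z).2 (lcval z').2 -> heq z z'.
Proof.
move=> [e1 [e2 h1]] [e1' [e2' h2]].
rewrite (eq_irrelevance e1' e1) (eq_irrelevance e2' e2) in h2.
exists e1, e2; apply: lcval_inj => /=; rewrite lcval_ocast h1 h2.
by case: (lcval z').
Qed.

Lemma path_operad : is_operad path_op.
Proof.
have [_ [_ [_ [_ [_ [_ [assoc_seq [assoc_par [unit_l unit_r]]]]]]]]] := hB.
split.
  move=> n k z hk; apply: lcval_inj => /=.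
  rewrite [lcval z]surjective_pairing.
  by rewrite (opc_neg hB (lcval z).1 hk) (opc_neg hB (lcval z).2 hk).
split.
  by move=> n k a x y; apply: lcval_inj => /=; rewrite !(opd_linear hB).
split.
  by move=> n k x; apply: lcval_inj => /=; rewrite !(opdK hB).
split.
  move=> m p n q i a x x' y hi; apply: lcval_inj => /=.
  by rewrite !path_opcompE // /pair_opcomp /= !(opcompl_linear hB _ hi).
split.
  move=> m p n q i a x y y' hi; apply: lcval_inj => /=.
  by rewrite !path_opcompE // /pair_opcomp /= !(opcompr_linear hB _ hi).
split.
  move=> m p n q i x y hi; apply: lcval_inj.
  rewrite [LHS]/= path_opcompE // lcvalD lcvalZ !lcval_ocast !path_opcompE //.
  by rewrite /pair_opcomp /= !(opcomp_leibniz hB _ _ hi).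
split.
  move=> l p m q n r i j x y z hi hj.
  have hij : (i + j < (l + m).-1)%N by lia.
  apply: heq_path; rewrite !path_opcompE // /pair_opcomp /= !path_opcompE //;
  exact: assoc_seq.
split.
  move=> l p m q n r i k x y z hi hk.
  have hkm : ((k + m).-1 < (l + m).-1)%N by lia.
  have hin : (i < (l + n).-1)%N by lia.
  have hil : (i < l)%N by lia.
  apply: heq_path; rewrite lcvalZ !path_opcompE // /pair_opcomp /= !path_opcompE //;
  exact: assoc_par.
split.
  by move=> n q y; apply: heq_path; rewrite path_opcompE //; apply: unit_l.
by move=> m p i x hi; apply: heq_path; rewrite path_opcompE //; apply: unit_r.
Qed.

Definition path_const : ohom B path_op :=
  fun n k x => path_elt (path_rel_const x).
Definition path_src : ohom path_op B := fun n k z => (lcval z).1.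
Definition path_tgt : ohom path_op B := fun n k z => (lcval z).2.

Lemma path_const_morphism : is_morphism path_const.
Proof.
split; first by move=> n k a x y; apply: lcval_inj.
split; first by move=> n k x; apply: lcval_inj.
split; last by apply: lcval_inj.
by move=> m p n q i x y hi; apply: lcval_inj; rewrite path_opcompE.
Qed.
Lemma path_src_morphism : is_morphism path_src.
Proof.
by do 2!split=> //; split=> // m p n q i x y hi; rewrite /path_src path_opcompE.
Qed.
Lemma path_tgt_morphism : is_morphism path_tgt.
Proof.
by do 2!split=> //; split=> // m p n q i x y hi; rewrite /path_tgt path_opcompE.
Qed.

Lemma path_ends_surj n k : k != 0 -> forall y0 y1 : opc B n k,
  exists z, path_src z = y0 /\ path_tgt z = y1.
Proof. by move=> hk y0 y1; exists (path_elt (path_rel_deg (y0, y1) hk)). Qed.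

Lemma path_const_qiso : acyclic_pos B -> quasi_iso path_const.
Proof.
move=> hacyc n k; split.
  by move=> z w _ /(congr1 (fun t => (lcval t).1)) hw; exists (lcval w).1.
move=> z' /(congr1 lcval) /= [hz1 hz2].
have [k_lt1|k_ge1] := ltrP (k - 1) 0.
  exists 0, 0; split; first exact: (opd0 hB).
  rewrite (opc_neg path_operad z' k_lt1) subr0; apply: lcval_inj => /=.
  by rewrite !(opd0 hB).
have [k1|k_neq1] := eqVneq k 1.
  subst k; have [c hc] := path_rel_of z' erefl; rewrite ocast_id in hc.
  exists (lcval z').2, (path_elt (path_rel_deg (- c, 0) (isT : (1 : int) != 0))).
  split=> //; apply: lcval_inj; rewrite lcvalB [lcval z']surjective_pairing.
  congr pair; first by rewrite /= (opdN hB) -hc opprB.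
  by rewrite /= (opd0 hB); apply: subrr.
have k_ge2 : 2 <= k by lia.
have [u hu] := hacyc n k k_ge2 _ hz1; have [v hv] := hacyc n k k_ge2 _ hz2.
have k_neq0 : k != 0 by lia.
exists 0, (path_elt (path_rel_deg (- u, - v) k_neq0)).
split; first exact: (opd0 hB).
apply: lcval_inj; rewrite lcvalB [lcval z']surjective_pairing /=.
by rewrite !(opdN hB) -hu -hv !sub0r.
Qed.

Lemma homotopic_of_homologous (B0 : dgop K) (F G : ohom B0 B) :
  acyclic_pos B -> is_morphism F -> is_morphism G ->
  (forall n (x : opc B0 n 0), homologous (F n 0 x) (G n 0 x)) -> homotopic F G.
Proof.
move=> hacyc hF hG hFG.
have hrel n k (x : opc B0 n k) : path_rel (F n k x, G n k x).
  by move=> e; subst k; rewrite ocast_id; apply: hFG.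
pose H : ohom B0 path_op := fun n k x => path_elt (hrel n k x).
exists path_op, path_const, path_src, path_tgt, H; split.
  split; [exact: path_operad | exact: path_const_morphism | exact: path_src_morphism
         | exact: path_tgt_morphism | exact: path_const_qiso].
do 2!split=> //.
  by move=> n k hk; apply: path_ends_surj; lia.
split=> //; split.
  move=> n k a x y; apply: lcval_inj.
  by rewrite /= !(morph_linear hF) !(morph_linear hG).
split.
  by move=> n k x; apply: lcval_inj; rewrite /= (morph_opd hF) (morph_opd hG).
split; last by apply: lcval_inj; rewrite /= (morph_unit hF) (morph_unit hG).
move=> m p n q i x y hi; apply: lcval_inj.
by rewrite path_opcompE // /pair_opcomp /= (morph_opcomp hF) // (morph_opcomp hG).
Qed.
End PathObject.

Lemma homotopic_homologous (K : fieldType) (B0 B1 : dgop K) (F G : ohom B0 B1) :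
  is_operad B1 -> homotopic F G ->
  forall n (x : opc B0 n 0), homologous (F n 0 x) (G n 0 x).
Proof.
move=> hB1 [P [s [p0 [p1 [H [[hP hs hp0 hp1 hsq] [hps [_ [_ hHp]]]]]]]]] n x.
have [z [w [_ hzw]]] := (hsq n 1).2 (H n 0 x) (opd_deg0 hP _).
have hzF : homologous z (F n 0 x).
  exists (p0 n 1 w); rewrite -(proj1 (hps n 0 z)) -(proj1 (hHp n 0 x)).
  by rewrite -(morphB hp0) hzw; exact: (morph_opd hp0 w).
have hzG : homologous z (G n 0 x).
  exists (p1 n 1 w); rewrite -(proj2 (hps n 0 z)) -(proj2 (hHp n 0 x)).
  by rewrite -(morphB hp1) hzw; exact: (morph_opd hp1 w).
by apply: (homologous_trans hB1 (homologous_sym hB1 hzF)).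
Qed.

Lemma oscale_morphism (K : fieldType) (O P : dgop K) (f : ohom O P) a :
  is_operad P -> is_morphism f -> a != 0 -> is_morphism (oscale a f).
Proof.
move=> hP hf a0; split.
  by move=> n k b x y; rewrite /oscale (morph_linear hf) scalerDr !scalerA mulrC.
split; first by move=> n k x; rewrite /oscale (morph_opd hf) (opdZ hP).
split; last by rewrite /oscale (morph_unit hf) expr0z scale1r.
move=> m p n q i x y hi.
rewrite /oscale (morph_opcomp hf) // (opcompZZ hP) // -expfzDr //.
by congr (a ^ _ *: _); lia.
Qed.

Section Coefficient.
Variables (K : fieldType) (O P : dgop K).
Hypotheses (hO : is_operad O) (hP : is_operad P).
Variables (e : opc O 0%N 0) (m : opc O 2%N 0) (e' : opc P 0%N 0) (m' : opc P 2%N 0).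
Hypotheses (hOass : ass_homology e m) (hPass : ass_homology e' m').

Definition has_coef (phi : ohom O P) (beta : K) : Prop :=
  forall n, homologous (phi n 0 (assoc_elt e m n))
                       (beta ^ (n%:Z - 1) *: assoc_elt e' m' n).

Lemma ass_gen_not_boundary : ~ boundary m'.
Proof.
case: hPass => _ hunit hme _ hm; apply: hunit.
apply: (homologous_boundary hP (homologous_sym hP hme)).
have hm0 : homologous m' 0 by rewrite /homologous subr0.
have := homologous_opcomp hP (isT : (0 < 2)%N) hm0 (homologous_refl hP e').
by rewrite (opcomp0l hP) // /homologous !subr0.
Qed.

Lemma morph_has_coef phi :
  is_morphism phi -> exists2 beta, beta != 0 & has_coef phi beta.
Proof.
move=> hphi; case: hOass => _ _ hme _; case: hPass => _ hunit hme' hspan.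
have [beta hbeta] : exists beta, homologous (phi 2%N 0 m) (beta *: m') := hspan _ _.
have [gam hgam] : exists gam, homologous (phi 0%N 0 e) (gam *: e') := hspan _ _.
have hbg : beta * gam = 1.
  apply: (homologous_scale hP hunit); rewrite scale1r.
  have h1 : homologous (opcomp 0 (phi 2%N 0 m) (phi 0%N 0 e)) (opunit P).
    rewrite -(morph_unit hphi) -(morph_opcomp hphi m e (isT : (0 < 2)%N)).
    exact: morph_homologous.
  have h2 := homologous_opcomp hP (isT : (0 < 2)%N) hbeta hgam.
  rewrite (opcompZZ hP) // in h2.
  apply: (homologous_trans hP (homologousZ hP _ (homologous_sym hP hme'))).
  by apply: (homologous_trans hP (homologous_sym hP h2)).
have beta0 : beta != 0.
  by apply: contra_eq_neq hbg => ->; rewrite mul0r eq_sym oner_neq0.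
exists beta => // n; rewrite (morph_assoc_elt _ _ _ hphi) -(assoc_eltZ hP).
apply: (assoc_elt_homologous hP n _ hbeta).
by rewrite -[beta^-1]mulr1 -hbg mulKf.
Qed.

Lemma has_coef_oscale phi beta a :
  has_coef phi beta -> has_coef (oscale a phi) (a * beta).
Proof. by move=> hc n; rewrite /oscale expfzMl -scalerA; apply: homologousZ. Qed.

Lemma homologous_of_has_coef (phi psi : ohom O P) beta :
  is_morphism phi -> is_morphism psi -> has_coef phi beta -> has_coef psi beta ->
  forall n (x : opc O n 0), homologous (phi n 0 x) (psi n 0 x).
Proof.
move=> hphi hpsi hc hc' n x; case: hOass => _ _ _ hspan.
have [lam hl] := hspan n x.
apply: (homologous_trans hP (morph_homologous hphi hl)); rewrite (morphZ hphi).
apply: (homologous_trans hP (homologousZ hP lam (hc n))).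
apply: (homologous_trans hP (homologousZ hP lam (homologous_sym hP (hc' n)))).
rewrite -(morphZ hpsi); apply: (morph_homologous hpsi (homologous_sym hO hl)).
Qed.

Lemma has_coef_homologous_eq (phi psi : ohom O P) beta beta' :
  (forall n (x : opc O n 0), homologous (phi n 0 x) (psi n 0 x)) ->
  has_coef phi beta -> has_coef psi beta' -> beta = beta'.
Proof.
move=> hphipsi hc hc'; apply: (homologous_scale hP ass_gen_not_boundary).
have := hc 2%N; have := hc' 2%N; rewrite /= (_ : (2%N)%:Z - 1 = 1) // !expr1z.
move=> hc2' hc2; apply: (homologous_trans hP (homologous_sym hP hc2)).
by apply: (homologous_trans hP (hphipsi 2%N m)).
Qed.
End Coefficient.

Theorem lemma2p3 (K : fieldType) (B0 B1 : dgop K)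
  (hA0 : A_infinity B0) (hA1 : A_infinity B1) (hcof : cofibrant B0)
  (f : ohom B0 B1) (hf : is_morphism f) :
  (forall a : K, a != 0 -> is_morphism (oscale a f)) /\
  (forall g : ohom B0 B1, is_morphism g ->
     exists a : K, a != 0 /\ homotopic (oscale a f) g) /\
  (forall a b : K, a != 0 -> b != 0 ->
     homotopic (oscale a f) (oscale b f) -> a = b).
Proof.
have [hB0 _] := hA0; have [hB1 _] := hA1.
have [e0 [m0 ass0]] := A_infinity_ass_homology hA0.
have [e1 [m1 ass1]] := A_infinity_ass_homology hA1.
have [beta beta0 coef_f] := morph_has_coef hB1 ass0 ass1 hf.
have hscale a : a != 0 -> is_morphism (oscale a f).
  by move=> a0; apply: oscale_morphism.
split=> //; split.
  move=> g hg; have [gam gam0 coef_g] := morph_has_coef hB1 ass0 ass1 hg.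
  have ratio0 : gam / beta != 0 by rewrite mulf_neq0 ?invr_eq0.
  exists (gam / beta); split=> //; have [hacyc _ _ _] := ass1.
  apply: (homotopic_of_homologous hB1 hacyc (hscale _ ratio0) hg).
  apply: (homologous_of_has_coef hB0 hB1 ass0 (hscale _ ratio0) hg _ coef_g).
  by rewrite -[X in has_coef _ _ _ _ _ X](divfK beta0); apply: has_coef_oscale.
move=> a b a0 b0 /(homotopic_homologous hB1) hab.
have := has_coef_homologous_eq hB1 ass1 hab (has_coef_oscale hB1 a coef_f)
  (has_coef_oscale hB1 b coef_f).
exact: mulIf.
Qed.
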